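(* Let $D=(V,A)$ be a finite loopless digraph with $f:A\to\mathbb{Z}\cup\{-\infty\}$, $g:A\to\mathbb{Z}\cup\{+\infty\}$, $f\le g$, let $B$ be an integral base-polyhedron with $B=B'(p)$ for the unique fully supermodular $p$, and let $F\subseteq A$ be such that $f,g$ are finite-valued on $F$. Assume: $F$ is non-empty and contains no edge $e$ with $f(e)=g(e)$; with $\beta=\max\{g(e):e\in F\}$, $L=L_\beta=\{e\in F:g(e)=\beta\}$ and $g^-=g-\chi_{L}$, the set $Q(f,g;B)\cap\mathbb{Z}^A$ is non-empty while $Q(f,g^-;B)\cap\mathbb{Z}^A$ is empty. Let $\mathcal C_L$ be a feasible chain of subsets of $V$ attaining the maximum of $\varrho_L(\mathcal C)-\sum_{C\in\mathcal C}[\varrho_g(C)-\delta_f(C)-p(C)]$ over all feasible chains $\mathcal C$, let $B_L=\{x\in B:\widetilde x(C)=p(C)\ \forall C\in\mathcal C_L\}$, and define $(f_L,g_L)$ as follows. For $e\in L$: $(f_L(e),g_L(e))=(\beta,\beta)$ if $e$ enters at least two members of $\mathcal C_L$; $(\beta-1,\beta)$ if $e$ enters exactly one member; $(f(e),f(e))$ if $e$ is $\mathcal C_L$-leaving; $(f(e),\beta-1)$ if $e$ is $\mathcal C_L$-neutral. For $e\in A-L$: $(g(e),g(e))$ if $e$ is $\mathcal C_L$-entering; $(f(e),f(e))$ if $\mathcal C_L$-leaving; $(f(e),g(e))$ if $\mathcal C_L$-neutral. Then there is a proper subset $F'\subsetneq F$ such that an element $z$ of $Q(f,g;B)\cap\mathbb{Z}^A$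 is $F$-dec-min in $Q(f,g;B)\cap\mathbb{Z}^A$ if and only if $z$ is an $F'$-dec-min member of $Q(f_L,g_L;B_L)\cap\mathbb{Z}^A$. In addition, $0\le g_L(e)-f_L(e)\le1$ for every $e\in F-F'$.
   Context: For $x\in\mathbb{R}^V$, $\widetilde x(Z)=\sum_{v\in Z}x(v)$. A base-polyhedron is $B'(p)=\{x:\widetilde x(V)=p(V),\ \widetilde x(Z)\ge p(Z)\ \forall Z\subset V\}$ with $p:2^V\to\mathbb{Z}\cup\{-\infty\}$, $p(\emptyset)=0$, $p(V)$ finite, $p(X)+p(Y)\le p(X\cap Y)+p(X\cup Y)$; a non-empty base-polyhedron determines $p$ uniquely by $p(Z)=\min\{\widetilde x(Z):x\in B\}$. For $x:A\to\mathbb{R}$, $\psi_x(v)=\sum_{uv\in A}x(uv)-\sum_{vu\in A}x(vu)$; $Q(f,g;B)=\{x\in\mathbb{R}^A:f\le x\le g,\ \psi_x\in B\}$. $\chi_L$ is the characteristic vector of $L$. $\varrho_g(C)$ (resp. $\delta_f(C)$) is the sum of $g$ (resp. $f$) over edges entering (resp. leaving) $C$. A chain $\mathcal C$ of subsets of $V$ is feasible if $\sum_{C\in\mathcal C}[\varrho_g(C)-\delta_f(C)-p(C)]<+\infty$. An edge is $\mathcal C$-entering / $\mathcal C$-leaving if it enters / leaves some member of $\mathcal C$, $\mathcal C$-neutral otherwise; $\varrho_L(\mathcal C)$ is the number of $\mathcal C$-entering edges of $L$. For $y,y'\in\mathbb{R}^F$, $y$ is decreasingly smaller than $y'$ if its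 decreasingly sorted component sequence is lexicographically smaller than that of $y'$; $z\in S\subseteq\mathbb{R}^A$ is $F$-dec-min in $S$ if no $z'\in S$ has $z'|_F$ decreasingly smaller than $z|_F$. *)

(* Defs.v *)
From HB Require Import structures.
From mathcomp Require Import all_boot all_order all_algebra.
From mathcomp Require Import classical_sets reals constructive_ereal.

Set Implicit Arguments.
Unset Strict Implicit.
Unset Printing Implicit Defensive.

Import Order.TTheory GRing.Theory Num.Theory.

Local Open Scope set_scope.
Local Open Scope ring_scope.
Local Open Scope ereal_scope.

(* Edges are an abstract finite type, so parallel edges are allowed. *)
Record digraph := Digraph {
  vertex : finType;
  edge : finType;
  src : edge -> vertex;
  tgt : edge -> vertex;
  loopless : forall e, src e != tgt e }.

(* Z together with -oo and/or +oo is [\bar int]; a function with values in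
   Z + {-oo} (resp. Z + {+oo}) is one that avoids +oo (resp. -oo). All the sums
   and differences below are then free of oo - oo. *)

Definition fully_supermodular (V : finType) (p : {set V} -> \bar int) : Prop :=
  [/\ forall X, p X != +oo,
      p finset.set0 = 0,
      p [set: V] \is a fin_num
    & forall X Y : {set V}, p X + p Y <= p (X :&: Y) + p (X :|: Y)].

Definition to_ereal (R : realType) (k : \bar int) : \bar R :=
  er_map (fun m : int => m%:~R%R) k.

Definition set_sum (R : realType) (V : finType) (x : V -> R) (Z : {set V}) : R :=
  (\sum_(v in Z) x v)%R.

Definition base_polyhedron (R : realType) (V : finType)
    (p : {set V} -> \bar int) : set (V -> R) :=
  fun x => (set_sum x [set: V])%:E = to_ereal R (p [set: V]) /\
    forall Z : {set V}, to_ereal R (p Z) <= (set_sum x Z)%:E.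

Definition net_in (R : realType) (D : digraph) (x : edge D -> R)
    (v : vertex D) : R :=
  (\sum_(e | tgt e == v) x e - \sum_(e | src e == v) x e)%R.

Definition submodular_flows (R : realType) (D : digraph)
    (f g : edge D -> \bar int) (B : set (vertex D -> R)) : set (edge D -> R) :=
  fun x => (forall e, to_ereal R (f e) <= (x e)%:E <= to_ereal R (g e)) /\
    B (net_in x).

Definition integral_vectors (R : realType) (T : Type) : set (T -> R) :=
  fun x => forall t, x t \is a Num.int.

Definition dec_sorted (R : realType) (T : finType) (F : {set T}) (y : T -> R) :
    seq R :=
  sort >=%R [seq y e | e <- enum F].

Definition dec_smaller (R : realType) (T : finType) (F : {set T})
    (y y' : T -> R) : bool :=
  ((dec_sorted F y : seqlexi R) < (dec_sorted F y' : seqlexi R))%O.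

Definition dec_min (R : realType) (T : finType) (F : {set T})
    (S : set (T -> R)) (z : T -> R) : Prop :=
  S z /\ ~ (exists2 z', S z' & dec_smaller F z' z).

Section Chains.
Context (D : digraph).
Implicit Types (e : edge D) (X : {set vertex D}) (L : {set edge D}).
Implicit Types (f g : edge D -> \bar int) (p : {set vertex D} -> \bar int).
Implicit Types (CC : {set {set vertex D}}).

Definition enters e X : bool := (src e \notin X) && (tgt e \in X).
Definition leaves e X : bool := (src e \in X) && (tgt e \notin X).

Definition in_sum g X : \bar int := \sum_(e | enters e X) g e.
Definition out_sum f X : \bar int := \sum_(e | leaves e X) f e.

Definition chain CC : Prop :=
  forall X Y, X \in CC -> Y \in CC -> (X \subset Y) || (Y \subset X).

Definition chain_excess f g p CC : \bar int :=
  \sum_(X in CC) (in_sum g X - out_sum f X - p X).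

Definition feasible_chain f g p CC : Prop :=
  chain CC /\ chain_excess f g p CC < +oo.

Definition chain_entering CC e : bool := [exists X in CC, enters e X].
Definition chain_leaving CC e : bool := [exists X in CC, leaves e X].
Definition enter_count CC e : nat := #|[set X in CC | enters e X]|.

Definition chain_value f g p L CC : \bar int :=
  #|[set e in L | chain_entering CC e]|%:R%:E - chain_excess f g p CC.

Definition optimal_chain f g p L CC : Prop :=
  feasible_chain f g p CC /\
  forall CC', feasible_chain f g p CC' ->
    chain_value f g p L CC' <= chain_value f g p L CC.

(* The maximum of g over F, for F nonempty and g finite on F. *)
Definition max_bound g (F : {set edge D}) : \bar int :=
  \big[maxe/-oo]_(e in F) g e.

Definition max_edges g (F : {set edge D}) : {set edge D} :=
  [set e in F | g e == max_bound g F].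

Definition decr_on L g : edge D -> \bar int := fun e => g e - (e \in L)%:R%:E.

(* No edge enters one member of a chain and leaves another one, so the order
   of the case distinctions is immaterial. *)
Definition chain_bounds f g (beta : \bar int) L CC e : \bar int * \bar int :=
  if e \in L then
    if (2 <= enter_count CC e)%N then (beta, beta)
    else if enter_count CC e == 1%N then (beta - 1, beta)
    else if chain_leaving CC e then (f e, f e)
    else (f e, beta - 1)
  else
    if chain_entering CC e then (g e, g e)
    else if chain_leaving CC e then (f e, f e)
    else (f e, g e).

Definition lower_bound f g beta L CC e := (chain_bounds f g beta L CC e).1.
Definition upper_bound f g beta L CC e := (chain_bounds f g beta L CC e).2.

Definition chain_face (R : realType) p CC (B : set (vertex D -> R)) :
    set (vertex D -> R) :=
  fun x => B x /\ forall X, X \in CC -> (set_sum x X)%:E = to_ereal R (p X).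

End Chains.

(* Main.v *)
(**
  Let k be the least number of edges of L that are saturated (take the value
  beta) in an integral flow of Q(f,g;B). A flow is F-dec-min only if it
  saturates exactly k edges, and the heart of the matter is the min-max formula
  k = max over feasible chains of their value. Given it, complementary slackness
  with the optimal chain CL identifies the flows saturating k edges with the
  integral members of Q(f_L,g_L;B_L). There every CL-entering edge of L has
  value beta - 1 or beta, with exactly k values beta, so these edges contribute
  the same multiset of values to every member; F' is F without them, and k > 0
  makes F' proper.

  The min-max formula is proved by induction on L. A chain with multiplicities
  is a potential q : V -> nat through its level sets, and the dual value of q is
  concave in the discrete sense that replacing two (shifted) potentials by their
  meet and join does not decrease the sum of the dual values. For an edge e of
  L, either no potential has dual value k with respect to L - e, and e may be
  saturated at cost 1, or concavity along the tension of e shows that the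
  capacity of e can be lowered by 1 without raising the maximal dual value.
*)
Require Import Defs.
From mathcomp Require Import all_boot all_order all_algebra.
From mathcomp Require Import boolp classical_sets reals constructive_ereal.
From mathcomp Require Import zify ring.

Set Implicit Arguments.
Unset Strict Implicit.
Unset Printing Implicit Defensive.

Import Order.TTheory GRing.Theory Num.Theory.

Local Open Scope ring_scope.

(** * Finite integral bounds *)

Section IntegerFlows.
(** [fam] models the sets on which a supermodular function is finite; being closed under
    intersection and union, it allows [p] to be integer-valued. *)
Context (D : digraph) (fam : pred {set vertex D}) (p : {set vertex D} -> int).
Hypothesis fam0 : fam finset.set0.
Hypothesis famT : fam [set: vertex D].
Hypothesis famI : forall X Y, fam X -> fam Y -> fam (X :&: Y).
Hypothesis famU : forall X Y, fam X -> fam Y -> fam (X :|: Y).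
Hypothesis p0 : p finset.set0 = 0.
Hypothesis pT : p [set: vertex D] = 0.
Hypothesis p_supermodular : forall X Y, fam X -> fam Y ->
  p X + p Y <= p (X :&: Y) + p (X :|: Y).

Implicit Types (f g z : edge D -> int) (X Y : {set vertex D}).
Implicit Types (L : {set edge D}) (q : vertex D -> nat).

(** Surplus of the cut condition at [X]. Taking both bounds equal to [z] gives net inflow minus
    [p X], so one formula serves for bounds and for flows. *)
Definition excess f g X : int :=
  \sum_(e | enters e X) g e - \sum_(e | leaves e X) f e - p X.

Definition feasible_flow f g z : Prop :=
  (forall e, f e <= z e <= g e) /\ forall X, fam X -> 0 <= excess z z X.

Lemma excess0 f g : excess f g finset.set0 = 0.
Proof.
by rewrite /excess p0 !big_pred0 ?subrr // => e; rewrite /enters /leaves !inE ?andbF.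
Qed.

Lemma excessT f g : excess f g [set: vertex D] = 0.
Proof.
by rewrite /excess pT !big_pred0 ?subrr // => e; rewrite /enters /leaves !inE ?andbF.
Qed.

Lemma excessE f g X : excess f g X =
  \sum_e ((enters e X)%:R * g e - (leaves e X)%:R * f e) - p X.
Proof.
rewrite /excess big_mkcond [X in _ - X - _]big_mkcond -sumrB; congr (_ - _).
by apply: eq_bigr => e _; do 2!case: ifP => _; rewrite ?mul1r ?mul0r.
Qed.

Lemma excess_submodular f g X Y : (forall e, f e <= g e) -> fam X -> fam Y ->
  excess f g (X :&: Y) + excess f g (X :|: Y) <= excess f g X + excess f g Y.
Proof.
move=> fg fX fY; have := p_supermodular fX fY.
rewrite !excessE.
set a := p X; set b := p Y; set c := p _; set d := p _ => le_p.
suff : \sum_e ((enters e (X :&: Y))%:R * g e - (leaves e (X :&: Y))%:R * f e)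
     + \sum_e ((enters e (X :|: Y))%:R * g e - (leaves e (X :|: Y))%:R * f e)
    <= \sum_e ((enters e X)%:R * g e - (leaves e X)%:R * f e)
     + \sum_e ((enters e Y)%:R * g e - (leaves e Y)%:R * f e) by lia.
(* Edge by edge, the two sides differ only for edges joining [X - Y] and [Y - X], by [g e - f e]. *)
rewrite -!big_split /=; apply: ler_sum => e _; have := fg e.
rewrite /enters /leaves !inE.
by do 4!case: (_ \in _); rewrite /= => fge; lia.
Qed.

Lemma excess_dec f g L X (h := fun e => g e - (e \in L)%:R) :
  excess f h X = excess f g X - (\sum_(e in L) enters e X)%:R.
Proof.
rewrite /excess /h sumrB natr_sum.
suff -> : \sum_(e | enters e X) (e \in L)%:R = \sum_(e in L) (enters e X)%:R :> int.
  by rewrite -!addrA; congr (_ + _); rewrite addrC -addrA.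
rewrite big_mkcond [RHS]big_mkcond; apply: eq_bigr => e _.
by do 2!case: ifP => //.
Qed.

Lemma excess_inc f g e X (h := fun e' => f e' + (e' == e)%:R) :
  excess h g X = excess f g X - (leaves e X)%:R.
Proof.
rewrite /excess /h big_split /=.
set a := \sum_(_ | _) g _; set b := \sum_(_ | _) f _.
suff -> : \sum_(e' | leaves e' X) (e' == e)%:R = (leaves e X)%:R :> int by lia.
rewrite big_mkcond (bigD1 e) //= eqxx big1 ?addr0; first by case: leaves.
by move=> e' /negPf ->; case: leaves.
Qed.

(* [excess_submodular] with the capacity of [e] lowered to [f e]; this keeps the
   term [g e - f e] that submodularity drops. *)
Lemma excess_cross f g e X Y : (forall e, f e <= g e) -> fam X -> fam Y ->
  (enters e X) -> (leaves e Y) ->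
  excess f g (X :&: Y) + excess f g (X :|: Y) + (g e - f e)
    <= excess f g X + excess f g Y.
Proof.
move=> fg fX fY eX eY.
pose h := fun e' => if e' == e then f e' else g e'.
have hE : forall Z, excess f h Z = excess f g Z - (enters e Z)%:R * (g e - f e).
  move=> Z; rewrite /excess big_mkcond [in RHS]big_mkcond /=.
  rewrite (bigD1 e) //= [in RHS](bigD1 e) //= {1}/h eqxx.
  rewrite (eq_bigr (fun e' => if enters e' Z then g e' else 0)); last first.
    by move=> e' /negPf ne; rewrite /h ne.
  by case: enters; lia.
have fh e' : f e' <= h e' by rewrite /h; case: ifP.
have := excess_submodular fh fX fY; rewrite !hE.
move: eX eY; rewrite /enters /leaves !inE.
by do 4!case: (_ \in _); rewrite //= ; lia.
Qed.

(** A Hoffman-type theorem, by induction on the total width of the intervals: at an edge with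
    [f e < g e], either [g e] can be lowered or [f e] can be raised without violating the cut
    condition. *)
Lemma flow_feasibility f g : (forall e, f e <= g e) ->
  (forall X, fam X -> 0 <= excess f g X) -> exists z, feasible_flow f g z.
Proof.
move: {2}(\sum_e `|g e - f e|)%N (leqnn (\sum_e `|g e - f e|)%N) => n.
elim: n f g => [|n IHn] f g le_n fg exc_ge0.
  have fgE e : f e = g e.
    move: le_n; rewrite leqn0 sum_nat_eq0 => /forallP/(_ e) /=.
    by rewrite absz_eq0 subr_eq0 => /eqP.
  exists f; split=> [e|X fX]; first by rewrite lexx fg.
  suff -> : excess f f X = excess f g X by exact: exc_ge0.
  by rewrite /excess; congr (_ - _ - _); apply: eq_bigr => e _; rewrite fgE.
have [fgE|[e fge]] : (forall e, f e = g e) \/ exists e, f e < g e.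
  have [/existsP[e fge]|] := boolP [exists e, f e < g e]; first by right; exists e.
  rewrite negb_exists => /forallP ge; left=> e; apply/eqP.
  by rewrite eq_le fg leNgt ge.
- apply: IHn => //; rewrite big1 // => e _; by rewrite fgE subrr.
have [/forallP gdec|] :=
    boolP [forall X, fam X ==> (0 <= excess f (fun e' => g e' - (e' \in [set e])%:R) X)].
  have [|e'|X fX|z [fzg zX]] := IHn f (fun e' => g e' - (e' \in [set e])%:R).
  - rewrite -ltnS; apply: leq_trans le_n.
    rewrite (bigD1 e) //= [X in (_ < X)%N](bigD1 e) //= set11 -addSn.
    apply: leq_add; first lia.
    by apply: leq_sum => e' /negPf; rewrite inE => ->; rewrite subr0.
  - by have := fg e'; rewrite inE; case: eqVneq => [->|_] /=; lia.
  - exact: (implyP (gdec X)).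
  by exists z; split=> // e'; have := fzg e'; case: (_ \in _) => /=; lia.
rewrite negb_forall => /existsP[X]; rewrite negb_imply excess_dec big_set1 => /andP[fX].
have eX0 := exc_ge0 _ fX.
case eX: (enters e X) => /= excX; last by lia.
have [|e'|Y fY|z [fzg zX]] := IHn (fun e' => f e' + (e' == e)%:R) g.
- rewrite -ltnS; apply: leq_trans le_n.
  rewrite (bigD1 e) //= [X in (_ < X)%N](bigD1 e) //= eqxx -addSn.
  apply: leq_add; first lia.
  by apply: leq_sum => e' /negPf ->; rewrite addr0.
- by have := fg e'; case: eqVneq => [->|_] /=; lia.
- rewrite excess_inc; have := exc_ge0 _ fY.
  case eY: (leaves e Y); last by lia.
  (* [X] blocks the lowering of [g e], so its excess is 0; hence a set [Y] left by [e] has excess at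
     least [g e - f e], and raising [f e] by 1 is harmless. *)
  have := excess_cross fg fX fY eX eY.
  have := exc_ge0 _ (famI fX fY); have := exc_ge0 _ (famU fX fY).
  by rewrite /=; lia.
by exists z; split=> // e'; have := fzg e'; case: (_ == _) => /=; lia.
Qed.

(** * Potentials and their dual values *)

Definition level q (i : nat) : {set vertex D} := [set v | i < q v]%N.

Definition potential q : Prop := forall i, fam (level q i).

(** The subtraction is truncated: an edge along which [q] does not increase has tension 0. *)
Definition tension q e : nat := (q (tgt e) - q (src e))%N.

Definition level_excess f g q : int :=
  \sum_(i < \max_v q v) excess f g (level q i).

(* The levels of [q] form a chain in which sets may be repeated; the number of
   levels entered by [e] is [tension q e]. *)
Definition dual_value f g L q : int :=
  (\sum_(e in L) (0 < tension q e)%N)%:R - level_excess f g q.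

(** Levels beyond the maximum are empty and have excess 0. This puts several potentials over a
    common range of levels. *)
Lemma level_excess_widen f g q n : (forall v, q v <= n)%N ->
  level_excess f g q = \sum_(i < n) excess f g (level q i).
Proof.
move=> q_n; have le_n : (\max_v q v <= n)%N by apply/bigmax_leqP.
rewrite /level_excess (big_ord_widen n (fun i => excess f g (level q i)) le_n).
rewrite [RHS](bigID (fun i : 'I_n => i < \max_v q v)%N) /= [X in _ + X]big1 ?addr0 //.
move=> i; rewrite -leqNgt => le_i; suff -> : level q i = finset.set0 by exact: excess0.
by apply/setP => v; rewrite !inE ltnNge (leq_trans _ le_i) // leq_bigmax.
Qed.

Lemma level_shift q a i : level (fun v => a + q v)%N (a + i) = level q i.
Proof. by apply/setP => v; rewrite !inE ltn_add2l. Qed.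

Lemma level_shift_lt q a i : (i < a)%N -> level (fun v => a + q v)%N i = [set: vertex D].
Proof. by move=> ia; apply/setP => v; rewrite !inE ltn_addr. Qed.

Lemma potential_shift q a : potential q -> potential (fun v => a + q v)%N.
Proof.
move=> qP i; have [/level_shift_lt -> //|ai] := ltnP i a.
by rewrite -(subnKC ai) level_shift.
Qed.

(** The shift only adds levels equal to the whole vertex set, whose excess is 0 because [p] vanishes
    there. *)
Lemma level_excess_shift f g q a :
  level_excess f g (fun v => a + q v)%N = level_excess f g q.
Proof.
rewrite (@level_excess_widen f g _ (a + \max_v q v)); last first.
  by move=> v; rewrite leq_add2l leq_bigmax.
rewrite big_split_ord /= big1 ?add0r => [|i _]; last first.
  by rewrite level_shift_lt ?excessT.
by apply: eq_bigr => i _; rewrite level_shift.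
Qed.

Lemma dual_value_shift f g L q a :
  dual_value f g L (fun v => a + q v)%N = dual_value f g L q.
Proof.
rewrite /dual_value level_excess_shift; congr (_%:R - _).
by apply: eq_bigr => e _; rewrite /tension subnDl.
Qed.

Lemma sum_enters_level q e n : (forall v, q v <= n)%N ->
  (\sum_(i < n) enters e (level q i))%N = tension q e.
Proof.
move=> q_n; have := q_n (src e); have := q_n (tgt e).
rewrite /tension; move qb: (q (tgt e)) => b; move qa: (q (src e)) => a b_n a_n.
(* Level [i] is entered by [e] exactly when [q (src e) <= i < q (tgt e)]. *)
rewrite (eq_bigr (fun i : 'I_n => (a <= i < b)%N : nat)) => [|i _]; last first.
  by rewrite /enters !inE qa qb -leqNgt.
elim: n {q_n} a b {qa qb} b_n a_n => [|n IHn] a b b_n a_n; first by rewrite big_ord0; lia.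
rewrite big_ord_recr /=.
have [bn|bn] := leqP b n.
  have [an|an] := leqP a n; first by rewrite IHn //; lia.
  by rewrite big1 => [|i _]; [lia | have := ltn_ord i; lia].
have [an|an] := leqP a n; last first.
  by rewrite big1 => [|i _]; [lia | have := ltn_ord i; lia].
have eqb : b = n.+1 by lia.
rewrite (eq_bigr (fun i : 'I_n => (a <= i < n)%N : nat)) => [|i _]; last first.
  by have := ltn_ord i; rewrite eqb; lia.
by rewrite IHn //; lia.
Qed.

Lemma level_excess_dec f g L q :
  level_excess f (fun e => g e - (e \in L)%:R) q =
    level_excess f g q - (\sum_(e in L) tension q e)%:R.
Proof.
rewrite /level_excess; set n := \max_v q v.
have q_n v : (q v <= n)%N by exact: leq_bigmax.
under [in RHS]eq_bigr => e _ do rewrite -(sum_enters_level e q_n).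
rewrite exchange_big /= natr_sum -sumrB.
by apply: eq_bigr => i _; rewrite excess_dec.
Qed.

(* Trading the count of entering edges against the capacities [g - chi_L] leaves
   a concave function of the tensions. *)
Lemma dual_valueE f g L q : dual_value f g L q =
  - (\sum_(e in L) (tension q e).-1)%:R
    - level_excess f (fun e => g e - (e \in L)%:R) q.
Proof.
rewrite level_excess_dec /dual_value.
suff -> : (\sum_(e in L) tension q e = \sum_(e in L) (tension q e).-1
          + \sum_(e in L) (0 < tension q e))%N by rewrite natrD; lia.
by rewrite -big_split; apply: eq_bigr => e _ /=; lia.
Qed.

Let meet q1 q2 : vertex D -> nat := fun v => minn (q1 v) (q2 v).
Let join q1 q2 : vertex D -> nat := fun v => maxn (q1 v) (q2 v).

Lemma level_meet q1 q2 i : level (meet q1 q2) i = level q1 i :&: level q2 i.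
Proof. by apply/setP => v; rewrite !inE leq_min. Qed.

Lemma level_join q1 q2 i : level (join q1 q2) i = level q1 i :|: level q2 i.
Proof. by apply/setP => v; rewrite !inE leq_max. Qed.

Lemma potential_meet q1 q2 : potential q1 -> potential q2 -> potential (meet q1 q2).
Proof. by move=> q1P q2P i; rewrite level_meet; apply: famI. Qed.

Lemma potential_join q1 q2 : potential q1 -> potential q2 -> potential (join q1 q2).
Proof. by move=> q1P q2P i; rewrite level_join; apply: famU. Qed.

Lemma level_excess_submodular f g q1 q2 : (forall e, f e <= g e) ->
  potential q1 -> potential q2 ->
  level_excess f g (meet q1 q2) + level_excess f g (join q1 q2)
    <= level_excess f g q1 + level_excess f g q2.
Proof.
move=> fg q1P q2P; pose n := (\max_v q1 v + \max_v q2 v)%N.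
have q1n v : (q1 v <= n)%N by rewrite (leq_trans (leq_bigmax v)) ?leq_addr.
have q2n v : (q2 v <= n)%N by rewrite (leq_trans (leq_bigmax v)) ?leq_addl.
rewrite (level_excess_widen _ _ q1n) (level_excess_widen _ _ q2n).
rewrite (@level_excess_widen _ _ (meet _ _) n) => [|v]; last first.
  by rewrite (leq_trans (geq_minl _ _)).
rewrite (@level_excess_widen _ _ (join _ _) n) => [|v]; last by rewrite geq_max q1n q2n.
rewrite -!big_split; apply: ler_sum => i _ /=.
by rewrite level_meet level_join excess_submodular.
Qed.

Lemma dual_value_supermodular f g L q1 q2 :
  (forall e, f e <= g e - (e \in L)%:R) -> potential q1 -> potential q2 ->
  dual_value f g L q1 + dual_value f g L q2
    <= dual_value f g L (meet q1 q2) + dual_value f g L (join q1 q2).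
Proof.
move=> fg q1P q2P; have := level_excess_submodular fg q1P q2P.
rewrite !dual_valueE.
(* The truncated value of [q (tgt e) - q (src e) - 1] is a convex function of a potential
   difference, hence submodular in [q]; the indicator of positive tension alone is not concave. *)
suff : (\sum_(e in L) (tension (meet q1 q2) e).-1
        + \sum_(e in L) (tension (join q1 q2) e).-1
        <= \sum_(e in L) (tension q1 e).-1 + \sum_(e in L) (tension q2 e).-1)%N by lia.
rewrite -!big_split; apply: leq_sum => e _ /=.
rewrite /tension /meet /join; lia.
Qed.

(* The discrete concavity behind the induction: [q1] and [q2] are shifted so
   that they differ by one at [src e], and replaced by their meet and join,
   which moves the tensions of [e] towards each other by one. *)
Lemma dual_value_exchange f g L e q1 q2 :
  (forall e, f e <= g e - (e \in L)%:R) -> potential q1 -> potential q2 ->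
  (1 < tension q1 e)%N -> (q2 (tgt e) <= q2 (src e))%N ->
  exists r1 r2, [/\ potential r1, potential r2,
    tension r1 e = (tension q1 e).-1,
    (r2 (src e) + q2 (tgt e)).+1 = (r2 (tgt e) + q2 (src e))%N
  & dual_value f g L q1 + dual_value f g L q2
    <= dual_value f g L r1 + dual_value f g L r2].
Proof.
move=> fg q1P q2P t1 t2.
have s1P := potential_shift (q2 (src e)) q1P.
have s2P := potential_shift (q1 (src e)).+1 q2P.
exists (join (fun v => q2 (src e) + q1 v) (fun v => (q1 (src e)).+1 + q2 v))%N.
exists (meet (fun v => q2 (src e) + q1 v) (fun v => (q1 (src e)).+1 + q2 v))%N.
split; [exact: potential_join | exact: potential_meet | | | ].
- by move: t1; rewrite /tension /join; lia.
- by move: t1; rewrite /tension /meet; lia.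
- rewrite -(dual_value_shift f g L q1 (q2 (src e))).
  rewrite -(dual_value_shift f g L q2 (q1 (src e)).+1).
  by rewrite [X in _ <= X]addrC dual_value_supermodular.
Qed.

Lemma potential_const0 : potential (fun=> 0%N).
Proof.
by move=> i; suff -> : level (fun=> 0%N) i = finset.set0 by []; apply/setP => v; rewrite !inE.
Qed.

(* A set of negative excess, repeated often enough, has arbitrarily large dual
   value. *)
Lemma excess_ge0_of_dual f g (k : int) :
  (forall q, potential q -> dual_value f g finset.set0 q <= k) ->
  forall X, fam X -> 0 <= excess f g X.
Proof.
move=> dual_le X fX; rewrite leNgt; apply/negP => exc_lt0.
pose n := (`|k|.+1)%N; pose q (v : vertex D) := if v \in X then n else 0%N.
have levelq i : (i < n)%N -> level q i = X.
  by move=> ltin; apply/setP => v; rewrite !inE /q; case: ifP.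
have qP : potential q.
  move=> i; have [/levelq -> //|n_i] := ltnP i n.
  suff -> : level q i = finset.set0 by [].
  by apply/setP => v; rewrite !inE /q; case: ifP => // _; rewrite ltnNge n_i.
have := dual_le _ qP; rewrite /dual_value big_set0.
rewrite (@level_excess_widen _ _ q n) => [|v]; last by rewrite /q; case: ifP.
under eq_bigr => i _ do rewrite levelq //.
rewrite sumr_const card_ord sub0r.
move: exc_lt0; set x := excess f g X => x0.
have : x *+ n <= - n%:R by rewrite -mulNrn ler_wMn2r //; lia.
by rewrite /n; lia.
Qed.

(** The hard direction of the min-max formula. Edges of [L] are removed one at a time; the room
    between [f e] and [g e] on [L] keeps the bounds consistent when a capacity is lowered. *)
Lemma min_saturation_duality f g L (k : int) :
  (forall e, f e <= g e - (e \in L)%:R) ->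
  (forall q, potential q -> dual_value f g L q <= k) ->
  exists2 z, feasible_flow f g z & (\sum_(e in L) (z e == g e))%:R <= k.
Proof.
move: {2}#|L| (erefl #|L|) => n; elim: n => [|n IHn] in f g L k *.
  move/eqP; rewrite cards_eq0 => /eqP -> fg dual_le.
  have [|z zP] := @flow_feasibility f g _ (excess_ge0_of_dual dual_le).
    by move=> e; have := fg e; rewrite inE; lia.
  exists z => //; rewrite big_set0.
  have := dual_le _ potential_const0.
  by rewrite /dual_value big_set0 /level_excess big1_eq big_ord0 subr0.
move=> cardL fg dual_le.
have /card_gt0P[e eL] : (0 < #|L|)%N by rewrite cardL.
have cardL' : #|L :\ e| = n by have := cardsD1 e L; rewrite cardL eL; lia.
have fg' e' : f e' <= g e' - (e' \in L :\ e)%:R.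
  by have := fg e'; rewrite in_setD1; case: (_ == _); rewrite /=; lia.
pose Phi q := dual_value f g (L :\ e) q.
have dual_Phi q : dual_value f g L q = Phi q + (0 < tension q e)%N%:R.
  by rewrite /Phi /dual_value (big_setD1 e) //= natrD; lia.
(* In the first case saturating [e] is affordable, as the other edges of [L] cost at most
   [k - 1]. *)
have [Phi_lt|] := lem (forall q, potential q -> Phi q <= k - 1).
  have [z zP z_le] := IHn f g (L :\ e) (k - 1) cardL' fg' Phi_lt.
  exists z => //; rewrite (big_setD1 e) //= natrD.
  by case: eqP => _ /=; lia.
move=> /existsNP[q0 /not_implyP[q0P /negP]]; rewrite -ltNge => q0_gt.
(* In particular, a potential with [Phi q = k] does not increase along [e]. *)
have Phi_le q : potential q -> Phi q <= k - (0 < tension q e)%N%:R.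
  by move=> qP; have := dual_le q qP; rewrite dual_Phi; lia.
(* [q2] is chosen with the largest tension among the potentials of value [k];
   a potential [q] violating [Phi_tension] could be exchanged with it. *)
pose slack d := `[< exists q, [/\ potential q, Phi q = k & q (src e) = d + q (tgt e)]%N >].
have slack_ex : exists d, slack d.
  have := Phi_le q0 q0P; rewrite /tension => q0_le.
  exists (q0 (src e) - q0 (tgt e))%N; apply/asboolP; exists q0; split=> //; lia.
case: (ex_minnP slack_ex) => d /asboolP[q2 [q2P q2_k q2_d]] d_min.
(* Lowering the capacity of [e] by 1 raises the dual value by [tension q e], so this is the bound
   needed to apply induction to the lowered capacity. *)
have Phi_tension m q : potential q -> tension q e = m -> Phi q + m%:R <= k.
  elim: m q => [|m IHm] q qP qm; first by have := Phi_le q qP; lia.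
  have := Phi_le q qP; rewrite qm /=.
  case: m qm IHm => [|m] qm IHm; [lia | move=> _].
  have [||r1 [r2 [r1P r2P r1m r2d le_r]]] := dual_value_exchange (e := e) fg' qP q2P.
  - by rewrite qm.
  - by rewrite q2_d leq_addl.
  have := IHm r1 r1P; rewrite r1m qm => /(_ erefl).
  (* The fall of [r2] along [e] is one less than that of [q2]: value [k] is excluded by minimality
     of [d], or by [Phi_le] when [d] is 0. *)
  suff : Phi r2 <= k - 1 by move: le_r; rewrite -!/(Phi _); lia.
  rewrite leNgt; apply/negP => r2_gt.
  have := Phi_le r2 r2P; rewrite /tension => r2_le.
  have /d_min : slack (r2 (src e) - r2 (tgt e))%N.
    by apply/asboolP; exists r2; split=> //; lia.
  by lia.
(* The lowered capacity keeps [z e] below [g e], so [e] adds nothing to the count. *)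
have [| |z [fzg zP] z_le] :=
    IHn f (fun e' => g e' - (e' \in [set e])%:R) (L :\ e) k cardL'.
- by move=> e'; have := fg e'; rewrite !inE; case: eqVneq => [->|_] /=; rewrite ?eL; lia.
- move=> q qP; have := Phi_tension _ q qP erefl.
  by rewrite /Phi /dual_value level_excess_dec big_set1; lia.
exists z; first by split=> // e'; have := fzg e'; rewrite inE; lia.
rewrite (big_setD1 e) //=; have /andP[_] := fzg e; rewrite set11 => z_lt.
have -> : (z e == g e) = false by lia.
rewrite add0n; apply: le_trans z_le.
rewrite ler_nat; apply: leq_sum => e'; rewrite !inE => /andP[/negPf -> _].
by rewrite subr0.
Qed.

End IntegerFlows.
(** * Decreasing lexicographic order *)

(** If the heads differ, the larger one is absent from the other sequence and serves as [a]; equal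
    heads cancel. *)
Lemma ltxi_sorted_count (R : realDomainType) (s t : seq R) :
  sorted >=%R s -> sorted >=%R t ->
  ((s : seqlexi R) < (t : seqlexi R))%O <->
  exists2 a, (count_mem a s < count_mem a t)%N &
             forall b, a < b -> count_mem b s = count_mem b t.
Proof.
have ge_trans : transitive (>=%R : rel R) by move=> x y z; apply/Order.POrderTheory.ge_trans.
have count0 x (u : seq R) b : path >=%R x u -> x < b -> count_mem b (x :: u) = 0%N.
  move=> xu xb; apply/count_memPn; rewrite inE negb_or gt_eqF //=.
  apply/negP => bu; move: xu; rewrite (path_sortedE ge_trans) => /andP[/allP/(_ _ bu) /=].
  by rewrite leNgt xb.
elim: s t => [|x s IHs] [|y t] s_sorted t_sorted.
- by rewrite ltxx; split=> // -[a].
- rewrite ltxi0s; split=> // _; exists y => [|b yb]; first by rewrite /= eqxx.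
  by rewrite count0.
- by rewrite ltxis0; split=> // -[a].
have [xy|yx|xy] := ltgtP x y.
- rewrite ltxi_cons (ltW xy) leNgt xy implyFb andbT; split=> // _.
  exists y => [|b yb]; first by rewrite count0 //= eqxx.
  by rewrite !count0 // (lt_trans xy).
- rewrite ltxi_cons leNgt yx andFb; split=> // -[a lt_a eq_a].
  have [xa|ax] := leP x a; first by rewrite (count0 y t) // (lt_le_trans yx) in lt_a.
  by have := eq_a _ ax; rewrite (count0 y t) //= eqxx.
- rewrite xy ltxi_cons lexx andTb implyTb.
  have -> := IHs t (path_sorted s_sorted) (path_sorted t_sorted).
  split=> -[a lt_a eq_a]; exists a => [|b ab]; first by rewrite ltn_add2l.
  + by rewrite /= eq_a.
  + by move: lt_a; rewrite ltn_add2l.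
  + by have := eq_a _ ab; rewrite /=; lia.
Qed.

Lemma dec_smaller_count (R : realType) (T : finType) (F : {set T}) (y y' : T -> R) :
  dec_smaller F y y' <->
  exists2 a, (#|[set e in F | y e == a]| < #|[set e in F | y' e == a]|)%N &
    forall b, a < b -> #|[set e in F | y e == b]| = #|[set e in F | y' e == b]|.
Proof.
have countE (x : T -> R) a : count_mem a (dec_sorted F x) = #|[set e in F | x e == a]|.
  rewrite /dec_sorted count_sort count_map -size_filter cardE /enum_mem -enumT.
  rewrite -filter_predI; congr size; apply: eq_filter => e.
  by rewrite /= !inE andbC.
rewrite /dec_smaller ltxi_sorted_count; last 2 first.
- by apply: sort_sorted => a b; apply: le_total.
- by apply: sort_sorted => a b; apply: le_total.
split=> -[a lt_a eq_a]; exists a => [|b /eq_a]; by rewrite ?countE // -?countE.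
Qed.

Section DecMin.
Context (R : realType) (T : finType) (F F' : {set T}) (Q Q' : set (T -> R)).
Context (b : R) (k : nat).
Let saturated (z : T -> R) := #|[set e in F | z e == b]|.
Hypothesis Q_le : forall z e, Q z -> e \in F -> z e <= b.
Hypothesis k_attained : exists2 z, Q z & saturated z = k.
Hypothesis k_le : forall z, Q z -> (k <= saturated z)%N.
Hypothesis Q'E : forall z, Q' z <-> Q z /\ saturated z = k.
Hypothesis F'F : F' \subset F.
Hypothesis Q'_count : forall z z' a, Q' z -> Q' z' ->
  #|[set e in F :\: F' | z e == a]| = #|[set e in F :\: F' | z' e == a]|.

(** No component on [F] exceeds [b], so the multiplicity of [b] is compared first. *)
Lemma saturated_dec_smaller z z' : Q z -> Q z' ->
  (saturated z < saturated z')%N -> dec_smaller F z z'.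
Proof.
move=> zQ z'Q lt_z; apply/dec_smaller_count; exists b => // a ba.
have sat0 y : Q y -> #|[set e in F | y e == a]| = 0%N.
  move=> yQ; apply: eq_card0 => e; rewrite !inE; apply/negP => /andP[eF].
  by rewrite lt_eqF // (le_lt_trans (Q_le yQ eF)).
by rewrite !sat0.
Qed.

Lemma dec_smaller_restrict z z' : Q' z -> Q' z' ->
  dec_smaller F z z' <-> dec_smaller F' z z'.
Proof.
move=> zQ z'Q.
have countE y a : #|[set e in F | y e == a]| =
    (#|[set e in F' | y e == a]| + #|[set e in F :\: F' | y e == a]|)%N.
  rewrite -(cardsID F'); congr (_ + _)%N; apply: eq_card => e; rewrite !inE.
    have := fintype.subsetP F'F e.
    by case: (e \in F') => [->|_]; rewrite ?andbT ?andbF ?andTb ?andFb.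
  by rewrite andbA.
split=> /dec_smaller_count[a lt_a eq_a]; apply/dec_smaller_count; exists a.
- by move: lt_a; rewrite !countE (Q'_count a zQ z'Q) ltn_add2r.
- by move=> c /eq_a; rewrite !countE (Q'_count c zQ z'Q) => /addIn.
- by rewrite !countE (Q'_count a zQ z'Q) ltn_add2r.
- by move=> c /eq_a; rewrite !countE (Q'_count c zQ z'Q) => ->.
Qed.

Lemma dec_min_reduction z : Q z -> (dec_min F Q z <-> dec_min F' Q' z).
Proof.
move=> zQ; split=> -[zS z_min]; split.
- apply/Q'E; split=> //; apply/eqP; rewrite eqn_leq k_le // andbT leqNgt.
  apply/negP => lt_k; have [y yQ yk] := k_attained.
  by apply: z_min; exists y => //; apply: saturated_dec_smaller; rewrite ?yk.
- move=> [y yQ' y_lt].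
  have zQ' : Q' z.
    apply/Q'E; split=> //; apply/eqP; rewrite eqn_leq k_le // andbT leqNgt.
    apply/negP => lt_k; have [x xQ xk] := k_attained.
    by apply: z_min; exists x => //; apply: saturated_dec_smaller; rewrite ?xk.
  apply: z_min; exists y; first by have /Q'E[] := yQ'.
  exact/dec_smaller_restrict.
- exact: zQ.
- move=> [y yQ y_lt]; have /Q'E[_ zk] := zS.
  (* A [y] decreasingly smaller than [z] cannot saturate more edges than [z] does, so it also
     attains the minimum [k]. *)
  have yQ' : Q' y.
    apply/Q'E; split=> //; apply/eqP; rewrite eqn_leq k_le // andbT leqNgt -zk.
    apply/negP => /(saturated_dec_smaller zQ yQ).
    by rewrite /dec_smaller ltNge (ltW y_lt).
  by apply: z_min; exists y => //; apply/dec_smaller_restrict.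
Qed.

End DecMin.

(** * Complementary slackness *)

(* [excess (fun=> 0) z z X] is the net inflow of [z] into [X]. *)
Definition int_flow (D : digraph) (f g : edge D -> \bar int)
    (p : {set vertex D} -> \bar int) (z : edge D -> int) : Prop :=
  (forall e, (f e <= (z e)%:E <= g e)%E) /\
  p [set: vertex D] = 0%E /\
  forall X : {set vertex D}, (p X <= (excess (fun=> 0) z z X)%:E)%E.

(** The surplus of a cut is the surplus of [z] plus the distances of [z] from the bounds on the cut;
    all of these are nonnegative for a feasible [z]. *)
Lemma excess_split (D : digraph) (p : {set vertex D} -> int) (f g z : edge D -> int) X :
  excess p f g X = excess p z z X +
    (\sum_(e | enters e X) (g e - z e) + \sum_(e | leaves e X) (z e - f e)).
Proof. by rewrite /excess !sumrB; ring. Qed.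

Section Slackness.
Context (D : digraph) (f g : edge D -> \bar int) (p : {set vertex D} -> \bar int).
Context (L : {set edge D}) (b : int) (CC : {set {set vertex D}}).
(** Integer stand-ins for [f], [g], [p], tied to them only where the chain makes use of their
    values. *)
Context (fi gi : edge D -> int) (pi : {set vertex D} -> int).
Hypothesis CC_chain : chain CC.
Hypothesis pE : forall X, X \in CC -> p X = (pi X)%:E.
Hypothesis gE : forall X e, X \in CC -> enters e X -> g e = (gi e)%:E.
Hypothesis fE : forall X e, X \in CC -> leaves e X -> f e = (fi e)%:E.
Hypothesis gL : forall e, e \in L -> g e = b%:E.
Hypothesis fL : forall e, e \in L -> (f e <= (b - 1)%:E)%E.

Let leave_count e := #|[set X in CC | leaves e X]|.

(** The contribution of [e] to the gap between the number of edges saturated by [z] and the value of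
    the chain. *)
Definition slack z e : int :=
  (e \in L)%:R * ((z e == b)%:R - (chain_entering CC e)%:R)
  + (enter_count CC e)%:R * (gi e - z e) + (leave_count e)%:R * (z e - fi e).

Lemma chain_excessE :
  chain_excess f g p CC = (\sum_(X in CC) excess pi fi gi X)%:E.
Proof.
rewrite /chain_excess -sumEFin; apply: eq_bigr => X XC.
rewrite /excess !EFinB pE // -!sumEFin; congr (_ - _ - _)%E.
  by apply: eq_bigr => e /(gE XC).
by apply: eq_bigr => e /(fE XC).
Qed.

Lemma chain_enteringE e : chain_entering CC e = (0 < enter_count CC e)%N.
Proof.
apply/existsP/card_gt0P => -[X XP]; exists X; move: XP; by rewrite inE.
Qed.

Lemma chain_leavingE e : chain_leaving CC e = (0 < leave_count e)%N.
Proof.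
apply/existsP/card_gt0P => -[X XP]; exists X; move: XP; by rewrite inE.
Qed.

(** A set entered by [e] contains its head but not its tail, a set left by [e] the reverse, so the
    two cannot be nested. *)
Lemma entering_not_leaving e : (0 < enter_count CC e)%N -> leave_count e = 0%N.
Proof.
rewrite -chain_enteringE => /existsP[X /andP[XC /andP[sX tX]]].
apply: eq_card0 => Y; rewrite !inE; apply/negP => /andP[YC /andP[sY tY]].
have /orP[/fintype.subsetP/(_ _ tX)|/fintype.subsetP/(_ _ sY)] := CC_chain XC YC.
  by rewrite (negPf tY).
by rewrite (negPf sX).
Qed.

(** The duality gap, obtained by exchanging the sums over edges and over members of the chain; weak
    duality and complementary slackness both follow from its terms being nonnegative. *)
Lemma excess_slack z :
  (\sum_(e in L) (z e == b))%:R
    - ((\sum_(e in L) chain_entering CC e)%:R - \sum_(X in CC) excess pi fi gi X)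
  = \sum_e slack z e + \sum_(X in CC) excess pi z z X.
Proof.
have excE X : excess pi fi gi X = excess pi z z X +
    \sum_e ((enters e X)%:R * (gi e - z e) + (leaves e X)%:R * (z e - fi e)).
  rewrite !excessE addrAC -big_split /=; congr (_ - _).
  by apply: eq_bigr => e _; lia.
rewrite (eq_bigr _ (fun X _ => excE X)) big_split /= exchange_big /=.
have -> : \sum_e slack z e = (\sum_(e in L) (z e == b))%:R
    - (\sum_(e in L) chain_entering CC e)%:R
    + \sum_e \sum_(X in CC)
        ((enters e X)%:R * (gi e - z e) + (leaves e X)%:R * (z e - fi e)).
  rewrite !natr_sum -sumrB [\sum_(e in L) _]big_mkcond -big_split.
  apply: eq_bigr => e _; rewrite /slack -addrA; congr (_ + _) => /=.
    by case: (e \in L); rewrite ?mul1r ?mul0r.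
  rewrite big_split -!mulr_suml -!natr_sum /=; congr (_%:R * _ + _%:R * _).
    by rewrite /enter_count -sum1dep_card big_mkcondr.
  by rewrite /leave_count -sum1dep_card big_mkcondr.
rewrite opprB; set a := _%:R; set c := _%:R; set d := \sum_(X in CC) _; set h := \sum_e _.
by clear; lia.
Qed.

(** This is where the new bounds come from. On [L], an edge entering [m > 0] members has slack
    [[z e = b] - 1 + m (b - z e)], which vanishes only at [b] if [m >= 2], and at [b - 1] and [b] if
    [m = 1]. A leaving edge must sit at [f e], and a neutral one must avoid [b]. *)
Lemma slack_spec z e : (f e <= (z e)%:E <= g e)%E ->
  0 <= slack z e /\
  (slack z e = 0 <-> (lower_bound f g b%:E L CC e <= (z e)%:E
                       <= upper_bound f g b%:E L CC e)%E).
Proof.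
move=> /andP[fz zg]; rewrite /slack /lower_bound /upper_bound /chain_bounds.
rewrite chain_enteringE chain_leavingE.
have gE' : (0 < enter_count CC e)%N -> g e = (gi e)%:E.
  by rewrite -chain_enteringE => /existsP[X /andP[XC]]; apply: gE.
have fE' : (0 < leave_count e)%N -> f e = (fi e)%:E.
  by rewrite -chain_leavingE => /existsP[X /andP[XC]]; apply: fE.
have := @entering_not_leaving e.
have eL : e \in L -> g e = b%:E /\ (f e <= (b - 1)%:E)%E by move=> eL; rewrite gL ?fL.
move: (enter_count CC e) (leave_count e) fz zg gE' fE' eL.
move=> m n fz zg gE' fE' eL; case: m gE' => [|m] gE' => [_|/(_ isT) ->].
  rewrite ltnn mul0r addr0 subr0 /=.
  case: n fE' => [_|n /(_ isT) feE].
    rewrite ltnn mul0r addr0; case: (e \in L) eL => [/(_ isT) [geE _]|_] /=.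
      by move: zg; rewrite fz geE !lee_fin; lia.
    by rewrite mul0r fz zg.
  rewrite feE in fz *; move: fz; rewrite lee_fin => fz.
  case: (e \in L) eL => [/(_ isT) [geE]|_] /=; rewrite !lee_fin; last by nia.
  by rewrite feE lee_fin; nia.
move: zg; rewrite gE' // lee_fin mul0r addr0 => zg.
case: (e \in L) eL => [/(_ isT) [geE _]|_] /=; last by rewrite !lee_fin; nia.
have {geE} gb : gi e = b by move: geE; rewrite gE' // => -[].
case: m gE' => [|m] _ /=; rewrite ?lee_fin.
  by case: eqP; lia.
by case: eqP; nia.
Qed.

Hypothesis CC_excess : forall z X, X \in CC -> int_flow f g p z -> 0 <= excess pi z z X.

Lemma saturated_ge z : int_flow f g p z ->
  (\sum_(e in L) chain_entering CC e)%:R - \sum_(X in CC) excess pi fi gi X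
    <= (\sum_(e in L) (z e == b))%:R.
Proof.
move=> zP; rewrite -subr_ge0 excess_slack; apply: addr_ge0.
  by apply: sumr_ge0 => e _; have [] := slack_spec (zP.1 e).
by apply: sumr_ge0 => X XC; apply: CC_excess.
Qed.

Lemma saturated_eq z : int_flow f g p z ->
  (\sum_(e in L) (z e == b))%:R
    = (\sum_(e in L) chain_entering CC e)%:R - \sum_(X in CC) excess pi fi gi X
  <-> (forall e, lower_bound f g b%:E L CC e <= (z e)%:E
                   <= upper_bound f g b%:E L CC e)%E
      /\ forall X, X \in CC -> excess pi z z X = 0.
Proof.
move=> zP.
have slack_ge0 e : 0 <= slack z e by have [] := slack_spec (zP.1 e).
have exc_ge0 X : X \in CC -> 0 <= excess pi z z X by move=> XC; apply: CC_excess.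
have -> : forall x y : int, x = y <-> x - y == 0.
  by move=> x y; rewrite subr_eq0; split=> /eqP.
rewrite excess_slack paddr_eq0; [| exact: sumr_ge0 | exact: sumr_ge0].
rewrite !psumr_eq0 //; split.
  move=> /andP[/allP sl0 /allP ex0]; split=> [e|X XC].
    have [_ <-] := slack_spec (zP.1 e).
    by apply/eqP; exact: sl0 (mem_index_enum _).
  by have := ex0 X (mem_index_enum _); rewrite XC => /eqP.
move=> [bnd ex0]; apply/andP; split; apply/allP.
  by move=> e _; apply/eqP; have [_ ->] := slack_spec (zP.1 e).
by move=> X _; apply/implyP => XC; rewrite ex0.
Qed.

End Slackness.

(** * Duality with infinite bounds *)

Lemma sume_lty_fin (I : finType) (P : {pred I}) (F : I -> \bar int) :
  (forall i, P i -> F i != -oo%E) -> (\sum_(i | P i) F i < +oo)%E ->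
  forall i, P i -> F i \is a fin_num.
Proof.
move=> F_gt; rewrite ltey esum_eqy // => /existsPn F_lt i Pi.
by rewrite fin_numE F_gt //=; have := F_lt i; rewrite unfold_in Pi.
Qed.

(** No term of the excess can be [-oo], so a total below [+oo] forces every term, and then every
    summand inside it, to be finite. *)
Lemma feasible_chain_fin (D : digraph) (f g : edge D -> \bar int)
    (p : {set vertex D} -> \bar int) (CC : {set {set vertex D}}) :
  (forall e, f e != +oo%E) -> (forall e, g e != -oo%E) -> (forall X, p X != +oo%E) ->
  (chain_excess f g p CC < +oo)%E ->
  forall X, X \in CC ->
    [/\ p X \is a fin_num, forall e, enters e X -> g e \is a fin_num
      & forall e, leaves e X -> f e \is a fin_num].
Proof.
move=> f_lt g_gt p_lt exc_lt X XC.
have in_gt Y : in_sum g Y != -oo%E.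
  by rewrite esum_eqNy; apply/existsPn => e; rewrite negb_and g_gt orbT.
have out_lt Y : (out_sum f Y < +oo)%E by apply: lte_sum_pinfty => e _; rewrite ltey.
have term_fin := sume_lty_fin _ exc_lt.
have /(_ X XC) : forall Y, Y \in CC -> (in_sum g Y - out_sum f Y - p Y)%E \is a fin_num.
  apply: term_fin => Y _; have := p_lt Y; have := in_gt Y; have := out_lt Y.
  by case: (in_sum g Y) => [?| |]; case: (out_sum f Y) => [?| |]; case: (p Y).
rewrite !fin_numB => /andP[/andP[in_fin out_fin] p_fin]; split=> // e eX.
  have in_lt : (in_sum g X < +oo)%E by move: in_fin; rewrite ltey fin_numE => /andP[].
  exact: (sume_lty_fin (fun e _ => g_gt e) in_lt).
rewrite fin_numE f_lt andbT; apply: contraTN out_fin => /eqP fe.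
suff -> : out_sum f X = -oo%E by [].
by apply/eqP; rewrite esum_eqNy; apply/existsP; exists e; rewrite unfold_in eX fe eqxx.
Qed.

(* Infinite bounds are replaced by bounds at distance [K] from a feasible flow
   [z0]; a set whose excess was infinite then has excess at least [K], too much
   for a chain containing it to have value above [k]. *)
Lemma chain_duality (D : digraph) (f g : edge D -> \bar int)
    (p : {set vertex D} -> \bar int) (L : {set edge D}) (b k : int)
    (z0 : edge D -> int) :
  (forall e, f e != +oo%E) -> (forall e, g e != -oo%E) ->
  fully_supermodular p -> int_flow f g p z0 ->
  (forall e, e \in L -> f e \is a fin_num) ->
  (forall e, e \in L -> g e = b%:E) ->
  (forall e, e \in L -> (f e <= (b - 1)%:E)%E) ->
  (forall CC, feasible_chain f g p CC -> (chain_value f g p L CC <= k%:E)%E) ->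
  exists2 z, int_flow f g p z & (\sum_(e in L) (z e == b))%:R <= k.
Proof.
move=> f_lt g_gt [p_lt p0 pT_fin p_super] z0P f_fin gL fL value_le.
pose fam X := p X \is a fin_num.
pose pi X := fine (p X).
have piE X : fam X -> p X = (pi X)%:E by move=> pX; rewrite fineK.
(* A chain enters at most [#|L|] edges of [L], so excess at least [K] brings its value down to at
   most [- |k| <= k]. *)
pose K : nat := (#|L| + `|k|)%N.
pose fi e := if f e \is a fin_num then fine (f e) else z0 e - K%:R.
pose gi e := if g e \is a fin_num then fine (g e) else z0 e + K%:R.
have fam0 : fam finset.set0 by rewrite /fam p0.
have pi0 : pi finset.set0 = 0 by rewrite /pi p0.
have piT : pi [set: vertex D] = 0 by rewrite /pi z0P.2.1.
have famIU X Y : fam X -> fam Y -> fam (X :&: Y) /\ fam (X :|: Y).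
  move=> fX fY; have := p_super X Y; have := p_lt (X :&: Y); have := p_lt (X :|: Y).
  rewrite /fam (piE X fX) (piE Y fY).
  by case: (p (X :&: Y)) => [?| |] //; case: (p (X :|: Y)) => [?| |].
have pi_super X Y : fam X -> fam Y -> pi X + pi Y <= pi (X :&: Y) + pi (X :|: Y).
  move=> fX fY; have [fI fU] := famIU X Y fX fY.
  by have := p_super X Y; rewrite !piE // -!EFinD lee_fin.
have fi_z0 e : fi e <= z0 e <= gi e.
  have /andP[] := z0P.1 e; rewrite /fi /gi.
  case: (f e) => [r| |]; case: (g e) => [s| |]; rewrite //= ?lee_fin; lia.
have figi e : fi e <= gi e - (e \in L)%:R.
  have := fi_z0 e; have [eL|_] := boolP (e \in L); last lia.
  have := fL e eL; rewrite /fi /gi f_fin // gL //= -[X in (X <= _)%E](fineK (f_fin e eL)).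
  by rewrite lee_fin.
have exc_z0 X : fam X -> 0 <= excess pi z0 z0 X.
  move=> fX; have := z0P.2.2 X; rewrite piE // lee_fin /excess; lia.
have dual_le q : potential fam q -> dual_value pi fi gi L q <= k.
  move=> qP; pose n := \max_v q v.
  (* Discarding repeated levels keeps every entered edge entered and drops only nonnegative
     excesses. *)
  pose CC := [set level q i | i : 'I_n].
  have CCP X : X \in CC -> fam X by move=> /imsetP[i _ ->]; apply: qP.
  have exc_ge0 X : X \in CC -> 0 <= excess pi fi gi X.
    move=> /CCP fX; rewrite (excess_split _ _ _ z0).
    apply: addr_ge0; first exact: exc_z0.
    by apply: addr_ge0; apply: sumr_ge0 => e _; have := fi_z0 e; lia.
  have CC_chain : chain CC.
    move=> _ _ /imsetP[i _ ->] /imsetP[j _ ->].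
    by case: (leqP i j) => ij; apply/orP; [right|left];
      apply/fintype.subsetP => v; rewrite !inE; apply: leq_trans; rewrite ltnS // ltnW.
  have entering_le : (\sum_(e in L) (0 < tension q e) <= \sum_(e in L) chain_entering CC e)%N.
    apply: leq_sum => e _; case: ltnP => // te; rewrite lt0b.
    have ltn : (q (src e) < n)%N.
      by apply: leq_trans (leq_bigmax (tgt e)); move: te; rewrite /tension subn_gt0.
    apply/existsP; exists (level q (Ordinal ltn)); rewrite imset_f //=.
    by rewrite /enters !inE ltnn /=; move: te; rewrite /tension subn_gt0.
  have excess_le : \sum_(X in CC) excess pi fi gi X <= level_excess pi fi gi q.
    rewrite /level_excess (partition_big_imset (fun i : 'I_n => level q i)) /=.
    apply: ler_sum => _ /imsetP[i _ ->]; rewrite (bigD1 i) //= ler_wpDr //.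
    by apply: sumr_ge0 => j _; apply: exc_ge0; apply: imset_f.
  have dual_chain : dual_value pi fi gi L q <=
      (\sum_(e in L) chain_entering CC e)%:R - \sum_(X in CC) excess pi fi gi X.
    by rewrite /dual_value lerB // ler_nat.
  apply: le_trans dual_chain _.
  (* Either the chain meets only finite bounds and is feasible for the original data, or some member
     has an infinite bound on its cut and excess at least [K]. *)
  have [[gE fE]|] := lem ((forall X e, X \in CC -> enters e X -> g e = (gi e)%:E) /\
                     (forall X e, X \in CC -> leaves e X -> f e = (fi e)%:E)).
    have exE := chain_excessE (fun X XC => piE X (CCP X XC)) gE fE.
    have := value_le CC; rewrite /feasible_chain /chain_value exE ltry.
    rewrite -EFinB lee_fin => /(_ (conj CC_chain isT)).
    by rewrite -sum1dep_card big_mkcondr.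
  move=> inf_edge.
  have [X XC KX] : exists2 X, X \in CC & K%:R <= excess pi fi gi X.
    have rest_ge0 (P : pred (edge D)) : 0 <= \sum_(e | P e) (gi e - z0 e) /\
        0 <= \sum_(e | P e) (z0 e - fi e).
      by split; apply: sumr_ge0 => e _; have := fi_z0 e; lia.
    have [] := (not_andP _ _).1 inf_edge => /existsNP[X /existsNP[e /not_implyP[XC]]];
      move=> /not_implyP[eX ne]; exists X => //; rewrite (excess_split _ _ _ z0);
      have := exc_z0 X (CCP X XC).
      have [_] := rest_ge0 (fun e' => leaves e' X).
      have [+ _] := rest_ge0 (fun e' => enters e' X && (e' != e)).
      rewrite [\sum_(e | enters e X) _](bigD1 e) //=.
      move: (excess _ _ _ _) (\sum_(_ | _) _) (\sum_(_ | _) _) => x y w.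
      suff -> : gi e = z0 e + K%:R by lia.
      by rewrite /gi; case: ifP => // ge; case: ne; rewrite /gi ge fineK.
    have [+ _] := rest_ge0 (fun e' => enters e' X).
    have [_] := rest_ge0 (fun e' => leaves e' X && (e' != e)).
    rewrite [\sum_(e | leaves e X) _](bigD1 e) //=.
    move: (excess _ _ _ _) (\sum_(_ | _) _) (\sum_(_ | _) _) => x y w.
    suff -> : fi e = z0 e - K%:R by lia.
    by rewrite /fi; case: ifP => // fe; case: ne; rewrite /fi fe fineK.
  rewrite (bigD1 X) //=.
  have : (\sum_(e in L) chain_entering CC e <= #|L|)%N.
    by rewrite -sum1_card; apply: leq_sum => e _; apply: leq_b1.
  have : 0 <= \sum_(Y in CC | Y != X) excess pi fi gi Y.
    by apply: sumr_ge0 => Y /andP[YC _]; apply: exc_ge0.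
  move: KX; rewrite /K; move: (excess _ _ _ _) (\sum_(_ | _) _) (\sum_(_ | _) _)%N.
  by clear; move=> x y w; lia.
have famI X Y : fam X -> fam Y -> fam (X :&: Y) by move=> fX /(famIU X Y fX)[].
have famU X Y : fam X -> fam Y -> fam (X :|: Y) by move=> fX /(famIU X Y fX)[].
have [z [fzg zP] z_le] :=
  min_saturation_duality fam0 pT_fin famI famU pi0 piT pi_super figi dual_le.
exists z.
  split=> [e|]; last split=> [|X]; [|exact: z0P.2.1|].
    have := fzg e; have := f_lt e; have := g_gt e; rewrite /fi /gi.
    case: (f e) => [r| |]; case: (g e) => [s| |] //=;
      rewrite ?lee_fin ?leNye ?leey // => _ _ /andP[]; lia.
  have [fX|] := boolP (fam X).
    by rewrite piE // lee_fin; have := zP X fX; rewrite /excess; lia.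
  by rewrite /fam fin_numE p_lt andbT negbK => /eqP ->; rewrite leNye.
apply: le_trans z_le; rewrite ler_nat; apply: leq_sum => e eL.
by rewrite /gi gL.
Qed.

(** * Integral points of real submodular flow polyhedra *)

Section IntegralPoints.
Context (R : realType) (D : digraph).
Implicit Types (f g : edge D -> \bar int) (p : {set vertex D} -> \bar int).
Implicit Types (z : edge D -> int) (X : {set vertex D}).

Definition embed z : edge D -> R := fun e => (z e)%:~R.

Lemma set_sum_net_in (x : edge D -> R) X :
  set_sum (net_in x) X = \sum_(e | enters e X) x e - \sum_(e | leaves e X) x e.
Proof.
have side (h : edge D -> vertex D) :
    \sum_(v in X) \sum_(e | h e == v) x e = \sum_(e | h e \in X) x e.
  rewrite (partition_big h (mem X)) //=; apply: eq_bigr => v vX.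
  by apply: eq_bigl => e; case: eqP => [->|]; rewrite ?andbT ?andbF.
rewrite /set_sum /net_in sumrB !side !(big_mkcond (fun e => _ \in X)) /=.
rewrite -sumrB [X in _ = X - _]big_mkcond [X in _ = _ - X]big_mkcond -sumrB.
apply: eq_bigr => e _; rewrite /enters /leaves.
by case: (src e \in X); case: (tgt e \in X); rewrite ?subrr.
Qed.

Lemma set_sum_embed z X :
  set_sum (net_in (embed z)) X = (excess (fun=> 0) z z X)%:~R.
Proof. by rewrite set_sum_net_in /excess subr0 intrB !rmorph_sum. Qed.

Lemma le_to_ereal (k : \bar int) (m : int) :
  (to_ereal R k <= (m%:~R)%:E)%E = (k <= m%:E)%E.
Proof. by case: k => [r| |] //=; rewrite ?lee_fin ?ler_int ?leNye. Qed.

Lemma ge_to_ereal (k : \bar int) (m : int) :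
  ((m%:~R)%:E <= to_ereal R k)%E = (m%:E <= k)%E.
Proof. by case: k => [r| |] //=; rewrite ?lee_fin ?ler_int ?leey. Qed.

Lemma eq_to_ereal (k : \bar int) (m : int) :
  (m%:~R)%:E = to_ereal R k <-> k = m%:E.
Proof.
split=> [|->] //; case: k => [r| |] //= [/eqP].
by rewrite eqr_int => /eqP ->.
Qed.

Lemma submodular_flows_embed f g p z :
  submodular_flows f g (@base_polyhedron R _ p) (embed z) <-> int_flow f g p z.
Proof.
(* The net inflow into the whole vertex set is 0, which is why membership in the base polyhedron
   amounts to [p] vanishing there. *)
have excT : excess (fun=> 0) z z [set: vertex D] = 0 by exact: excessT.
split=> -[fzg [pT pX]]; (split; first move=> e).
- by have := fzg e; rewrite /embed le_to_ereal ge_to_ereal.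
- split=> [|X]; first by move: pT; rewrite set_sum_embed excT => /eq_to_ereal.
  by have := pX X; rewrite set_sum_embed le_to_ereal.
- by rewrite /embed le_to_ereal ge_to_ereal.
- split=> [|X]; first by rewrite set_sum_embed excT; apply/eq_to_ereal.
  by rewrite set_sum_embed le_to_ereal.
Qed.

Lemma integral_vectorsP (x : edge D -> R) :
  integral_vectors x <-> exists z, x = embed z.
Proof.
split=> [x_int|[z ->] e]; last exact: intr_int.
exists (fun e => Num.floor (x e)); apply: funext => e.
by apply/esym/eqP; rewrite -intrEfloor.
Qed.

End IntegralPoints.

(** * Reduction to the face given by the optimal chain *)

Lemma max_bound_fin (D : digraph) (g : edge D -> \bar int) (F : {set edge D}) :
  F <> finset.set0 -> (forall e, e \in F -> g e \is a fin_num) ->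
  exists2 b, max_bound g F = b%:E & forall e, e \in F -> (g e <= b%:E)%E.
Proof.
move=> /eqP/set0Pn[e0 e0F] g_fin.
have le_max e : e \in F -> (g e <= max_bound g F)%E.
  by move=> eF; apply: (le_bigmax_cond _ _ eF).
have max_fin : max_bound g F \is a fin_num.
  rewrite fin_numE -ltNye -ltey; apply/andP; split.
    apply: lt_le_trans (le_max _ e0F); rewrite ltNye.
    by have := g_fin _ e0F; rewrite fin_numE => /andP[].
  apply: bigmax_lt => // e eF.
  by rewrite ltey; have := g_fin _ eF; rewrite fin_numE => /andP[].
by exists (fine (max_bound g F)) => [|e /le_max]; rewrite fineK.
Qed.

Lemma chain_bounds_within (D : digraph) (f g : edge D -> \bar int) (L : {set edge D})
    (b : int) (CC : {set {set vertex D}}) e :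
  (f e <= g e)%E -> (e \in L -> g e = b%:E) -> (e \in L -> (f e <= (b - 1)%:E)%E) ->
  (f e <= lower_bound f g b%:E L CC e)%E /\ (upper_bound f g b%:E L CC e <= g e)%E.
Proof.
rewrite /lower_bound /upper_bound /chain_bounds => fg gL fL.
case: (e \in L) gL fL => [/(_ isT) gE /(_ isT) fb|_ _]; last first.
  by do ?case: ifP => _ /=.
have bb : ((b - 1)%:E <= b%:E :> \bar int)%E by rewrite lee_fin; lia.
by rewrite gE in fg *; do ?case: ifP => _ /=; split=> //; apply: le_trans bb.
Qed.

Theorem theorem4p3 (R : realType) (D : digraph)
    (f g : edge D -> \bar int) (p : {set vertex D} -> \bar int)
    (B : set (vertex D -> R)) (F : {set edge D}) (CL : {set {set vertex D}})
    (f_lt_pinfty : forall e, f e <> +oo%E)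
    (g_gt_ninfty : forall e, g e <> -oo%E)
    (f_le_g : forall e, (f e <= g e)%E)
    (p_supermodular : fully_supermodular p)
    (B_def : B = base_polyhedron p)
    (f_fin_F : forall e, e \in F -> f e \is a fin_num)
    (g_fin_F : forall e, e \in F -> g e \is a fin_num)
    (F_nonempty : F <> finset.set0)
    (f_neq_g_F : forall e, e \in F -> f e <> g e) :
  let beta := max_bound g F in
  let L := max_edges g F in
  let Q := (submodular_flows f g B `&` @integral_vectors R (edge D))%classic in
  let Qminus :=
    (submodular_flows f (decr_on L g) B `&` @integral_vectors R (edge D))%classic in
  let fL := lower_bound f g beta L CL in
  let gL := upper_bound f g beta L CL in
  let BL := chain_face p CL B in
  let QL := (submodular_flows fL gL BL `&` @integral_vectors R (edge D))%classic in
  (Q !=set0)%classic ->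
  Qminus = classical_sets.set0 ->
  optimal_chain f g p L CL ->
  exists F' : {set edge D},
    [/\ F' \proper F,
        forall z : edge D -> R, Q z -> (dec_min F Q z <-> dec_min F' QL z)
      & forall e, e \in F :\: F' -> (0 <= gL e - fL e <= 1)%E].
Proof.
rewrite {B}B_def.
have [b max_bE g_le] := max_bound_fin F_nonempty g_fin_F.
move=> beta; have -> : beta = b%:E by []; move=> {beta} L Q Qminus fL gL BL QL.
move=> [x0 [x0Q x0_int]] Qminus0 [[CL_chain CL_fin] CL_max].
have f_lt e : f e != +oo%E by apply/eqP.
have g_gt e : g e != -oo%E by apply/eqP.
have [p_lt p0 pT_fin _] := p_supermodular.
have [z0 x0E] := (integral_vectorsP _).1 x0_int.
have z0P : int_flow f g p z0 by apply/(submodular_flows_embed R); rewrite -x0E.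
have LF e : e \in L -> e \in F by rewrite inE => /andP[].
have g_L e : e \in L -> g e = b%:E.
  rewrite inE => /andP[_ /eqP ->]; exact: max_bE.
have f_L e : e \in L -> (f e <= (b - 1)%:E)%E.
  move=> eL; have := f_le_g e; have := f_neq_g_F e (LF e eL); rewrite (g_L e eL).
  rewrite -(fineK (f_fin_F e (LF e eL))) !lee_fin => ne le_b.
  have : fine (f e) != b by apply/eqP => fb; apply: ne; rewrite fb.
  by move: le_b; move: (fine _) => m; lia.
pose fi e := fine (f e); pose gi e := fine (g e); pose pi X := fine (p X).
have CL_fins := feasible_chain_fin f_lt g_gt p_lt CL_fin.
have pE X : X \in CL -> p X = (pi X)%:E by move=> /CL_fins[pX _ _]; rewrite fineK.
have gE X e : X \in CL -> enters e X -> g e = (gi e)%:E.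
  by move=> /CL_fins[_ gX _] /gX ge; rewrite fineK.
have fE X e : X \in CL -> leaves e X -> f e = (fi e)%:E.
  by move=> /CL_fins[_ _ fX] /fX fe; rewrite fineK.
have CL_excess z X : X \in CL -> int_flow f g p z -> 0 <= excess pi z z X.
  by move=> XC [_ [_ /(_ X)]]; rewrite pE // lee_fin /excess; lia.
pose sat (z : edge D -> int) := (\sum_(e in L) (z e == b))%N.
pose k : int := (\sum_(e in L) chain_entering CL e)%:R - \sum_(X in CL) excess pi fi gi X.
have valueE : chain_value f g p L CL = k%:E.
  rewrite /chain_value (chain_excessE pE gE fE) -EFinB /k.
  by rewrite -sum1dep_card big_mkcondr.
have k_le z : int_flow f g p z -> k <= (sat z)%:R.
  by move=> zP; apply: (saturated_ge CL_chain gE fE g_L f_L CL_excess zP).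
(* Optimality of [CL] bounds the value of every feasible chain by [k], so strong duality yields a
   flow attaining the lower bound [k_le]. *)
have [z1 z1P z1_le] : exists2 z, int_flow f g p z & (sat z)%:R <= k.
  apply: (chain_duality f_lt g_gt p_supermodular z0P _ g_L f_L) => [e /LF|CC CCP].
    exact: f_fin_F.
  by rewrite -valueE; apply: CL_max.
have z1k : (sat z1)%:R = k by apply/eqP; rewrite eq_le z1_le k_le.
pose S := [set e in L | chain_entering CL e].
have SF : S \subset F by apply/fintype.subsetP => e; rewrite inE => /andP[/LF].
have FDS : F :\: (F :\: S) = S.
  by rewrite finset.setDDr finset.setDv finset.set0U; apply/finset.setIidPr.
have exc_ge0 : 0 <= \sum_(X in CL) excess pi fi gi X.
  apply: sumr_ge0 => X XC; rewrite (excess_split _ _ _ z0).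
  apply: addr_ge0; first exact: CL_excess.
  apply: addr_ge0; apply: sumr_ge0 => e eX; have /andP[] := z0P.1 e.
    by rewrite (gE X) // !lee_fin subr_ge0.
  by rewrite (fE X) // !lee_fin subr_ge0.
(* If [CL] entered no edge of [L], then [k <= 0], so [z1] would saturate nothing and belong to the
   empty set [Qminus]. *)
have S_neq0 : S != finset.set0.
  apply/negP => /eqP S0.
  have ent0 : (\sum_(e in L) chain_entering CL e = 0)%N.
    apply: big1 => e eL; have : e \notin S by rewrite S0 inE.
    by rewrite inE eL /= => /negPf ->.
  have sat0 : sat z1 = 0%N by move: z1k exc_ge0; rewrite /k ent0; lia.
  suff : Qminus (embed R z1) by rewrite Qminus0.
  split; last by apply/integral_vectorsP; exists z1.
  apply/submodular_flows_embed; split; last exact: z1P.2.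
  move=> e; have /andP[-> /=] := z1P.1 e; rewrite /decr_on.
  have [eL|_] := boolP (e \in L); last by rewrite sube0.
  have /eqP := sat0; rewrite sum_nat_eq0 => /forallP/(_ e); rewrite eL /= => z1e.
  by rewrite g_L // -EFinB !lee_fin; move: z1e; case: eqP => //; lia.
(* An edge of [F] with value [b] has upper bound [b], hence lies in [L]. *)
have satE z : int_flow f g p z -> #|[set e in F | embed R z e == b%:~R]| = sat z.
  move=> zP; rewrite -sum1dep_card /sat big_mkcondr [RHS]big_mkcond [LHS]big_mkcond.
  apply: eq_bigr => e _; rewrite /embed eqr_int.
  have [eL|eL] := boolP (e \in L); first by rewrite LF //; case: eqP.
  case: ifP => // eF; case: eqP => // ze; case/negP: eL.
  rewrite inE eF max_bE eq_le g_le //= -ze.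
  by have /andP[] := z1P.1 e; have /andP[] := zP.1 e.
have QE z : Q (embed R z) <-> int_flow f g p z.
  split=> [[/submodular_flows_embed //]|zP].
  by split; [apply/submodular_flows_embed | apply/integral_vectorsP; exists z].
have QLE z : QL (embed R z) <-> int_flow f g p z /\
    ((forall e, (fL e <= (z e)%:E <= gL e)%E) /\ forall X, X \in CL -> excess pi z z X = 0).
  have excE X : X \in CL -> (set_sum (net_in (embed R z)) X)%:E = to_ereal R (p X) <->
      excess pi z z X = 0.
    move=> XC; rewrite set_sum_embed eq_to_ereal pE //.
    have -> : excess pi z z X = excess (fun=> 0) z z X - pi X by rewrite /excess subr0.
    split=> [[->]|/eqP]; first by rewrite subrr.
    by rewrite subr_eq0 => /eqP ->.
  split=> [[[bnd [zB zCL]] _]|[zP [bnd exc0]]].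
    have fgz e : (fL e <= (z e)%:E <= gL e)%E.
      by have := bnd e; rewrite /embed le_to_ereal ge_to_ereal.
    split; last by split=> // X XC; apply/excE => //; apply: zCL.
    apply/(submodular_flows_embed R); split=> // e.
    have [fL_ge gL_le] := chain_bounds_within CL (f_le_g e) (g_L e) (f_L e).
    have /andP[fz zg] := fgz e.
    rewrite /embed le_to_ereal ge_to_ereal.
    by rewrite (le_trans fL_ge fz) (le_trans zg gL_le).
  have [_ zB] := (submodular_flows_embed R f g p z).2 zP.
  split; last by apply/integral_vectorsP; exists z.
  split=> [e|]; first by rewrite /embed le_to_ereal ge_to_ereal.
  by split=> // X XC; apply/excE => //; apply: exc0.
have sat_eq z (zP : int_flow f g p z) : (sat z)%:R = k <->
    ((forall e, (fL e <= (z e)%:E <= gL e)%E) /\ forall X, X \in CL -> excess pi z z X = 0).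
  exact: (saturated_eq CL_chain gE fE g_L f_L CL_excess zP).
(* On [S] the values are [b - 1] or [b]. The edges of [L] outside [S] stay below [b], so all
   saturated edges lie in [S] and their number is fixed. *)
have S_count z (a : R) : QL (embed R z) -> #|[set e in S | embed R z e == a]| =
    if a == b%:~R then sat z1 else if a == (b - 1)%:~R then (#|S| - sat z1)%N else 0%N.
  move=> /QLE[zP zL]; have zk := (sat_eq z zP).2 zL.
  have {}zk : sat z = sat z1 by apply/eqP; rewrite -(eqr_nat int) zk z1k.
  have zS e : e \in S -> b - 1 <= z e <= b.
    rewrite inE => /andP[eL]; rewrite chain_enteringE => ent.
    have := zL.1 e; rewrite /fL /gL /lower_bound /upper_bound /chain_bounds eL.
    by case: (enter_count CL e) ent => [|[|n]] //= _; rewrite !lee_fin; lia.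
  have S_b : #|[set e in S | z e == b]| = sat z1.
    rewrite -zk -sum1dep_card /sat big_mkcondr [RHS]big_mkcond [LHS]big_mkcond.
    apply: eq_bigr => e _; rewrite [e \in S]inE; have [eL|//] := boolP (e \in L).
    have := zL.1 e; rewrite /fL /gL /lower_bound /upper_bound /chain_bounds eL.
    rewrite chain_enteringE; case: (enter_count CL e) => [|n] /=; last by case: eqP.
    have fb := f_L e eL; have [ze|//] := eqVneq (z e) b; rewrite ze.
    by case: ifP => _ /= /andP[_]; [move=> /le_trans/(_ fb)|]; rewrite lee_fin; lia.
  case: eqP => [->|a_b].
    by rewrite -S_b; apply: eq_card => e; rewrite !inE /embed eqr_int.
  case: eqP => [->|a_b1].
    rewrite -S_b -(cardsID [set e | z e == b] S) -finset.setIdE addKn.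
    apply: eq_card => e.
    rewrite finset.in_setD [LHS]finset.in_set [X in ~~ X]finset.in_set /embed eqr_int.
    have := zS e; case: (e \in S) => [/(_ isT) ze|_]; last by rewrite andbF.
    by rewrite andbT; apply/idP/idP; lia.
  apply: eq_card0 => e; rewrite finset.in_set; apply/negP => /andP[/zS ze /eqP za].
  have := a_b; have := a_b1; rewrite -za /embed => /eqP + /eqP.
  by rewrite !eqr_int; lia.
exists (F :\: S); rewrite FDS; split.
- have /set0Pn[e eS] := S_neq0; rewrite finset.properEneq finset.subsetDl andbT.
  apply/negP => /eqP/setP/(_ e).
  by rewrite finset.in_setD eS (fintype.subsetP SF e eS).
- apply: (@dec_min_reduction R (edge D) F (F :\: S) Q QL b%:~R (sat z1)).
  + move=> x e [xQ /integral_vectorsP[z xE]] eF; rewrite {}xE in xQ *.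
    have zP := (submodular_flows_embed R f g p z).1 xQ.
    rewrite /embed ler_int -lee_fin.
    by have /andP[_ zg] := zP.1 e; apply: le_trans zg (g_le e eF).
  + by exists (embed R z1); [apply/QE | rewrite satE].
  + move=> x xQ; have [_ /integral_vectorsP[z xE]] := xQ; rewrite {}xE in xQ *.
    have zP := (QE z).1 xQ; rewrite satE // -(ler_nat int) z1k; exact: k_le.
  + move=> x; split=> [xQL|[xQ x_sat]].
      have [_ /integral_vectorsP[z xE]] := xQL; rewrite {}xE in xQL *.
      have [zP zsat] := (QLE z).1 xQL; split; first exact/QE.
      by rewrite satE //; apply/eqP; rewrite -(eqr_nat int) z1k; apply/eqP/sat_eq.
    have [_ /integral_vectorsP[z xE]] := xQ; rewrite {}xE in xQ x_sat *.
    have zP := (QE z).1 xQ; apply/QLE; split=> //; apply/sat_eq => //.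
    by rewrite -satE // x_sat.
  + exact: finset.subsetDl.
  + rewrite FDS => x y a xQ yQ.
    have [_ /integral_vectorsP[z xE]] := xQ; have [_ /integral_vectorsP[w yE]] := yQ.
    by subst x y; rewrite !S_count.
- move=> e; rewrite inE => /andP[eL]; rewrite chain_enteringE => ent.
  rewrite /fL /gL /lower_bound /upper_bound /chain_bounds eL.
  case: (enter_count CL e) ent => [|[|n]] //= _; rewrite -!EFinB !lee_fin; lia.
Qed.
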